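(* ${\sf SCAC}\equiv_{sc}\mathsf{SCAC^{small}}$, i.e. ${\sf SCAC}\le_{sc}\mathsf{SCAC^{small}}$ and $\mathsf{SCAC^{small}}\le_{sc}{\sf SCAC}$.
   Context: A poset $(P,\le_P)$ consists of $P\subseteq\omega$ and a reflexive, antisymmetric, transitive relation $\le_P$; chains (antichains) are sets of pairwise comparable (incomparable) elements. In an infinite poset, $x$ is small if $x\le_P y$ for all but finitely many $y\in P$, large if $y\le_P x$ for all but finitely many $y$, isolated if $x$ is incomparable with all but finitely many $y$. A poset is stable if every element is small or isolated (small type) or every element is large or isolated (large type). ${\sf SCAC}$ is the problem whose instances are infinite stable posets with $P\subseteq\omega$ and whose solutions are infinite chains or infinite antichains of the instance; $\mathsf{SCAC^{small}}$ is its restriction to instances of the small type. $\mathsf P\le_{sc}\mathsf Q$ means: for every $\mathsf P$-instance $X$ there is a $\mathsf Q$-instance $\hat X\le_T X$ such that for every solution $\hat Y$ of $\hat X$ there is a solution $Y$ of $X$ with $Y\le_T\hat Y$. *)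

(* Defs.v *)
From Stdlib Require Arith.Cantor.
From mathcomp Require Import all_boot.
From mathcomp Require Import boolp classical_sets cardinality.

Set Implicit Arguments.
Unset Strict Implicit.
Unset Printing Implicit Defensive.

Local Open Scope classical_set_scope.

(* Turing functionals are given by programs for the partial recursive functions
   relative to an oracle; [program k] is the type of programs of arity k. *)
Inductive program : nat -> Type :=
| Zero k : program k
| Succ : program 1
| Proj k (i : 'I_k) : program k
| Oracle : program 1
| Comp k m (f : program m) (g : 'I_m -> program k) : program k
| PrimRec k (f : program k) (g : program k.+2) : program k.+1
| Mu k (f : program k.+1) : program k.

Fixpoint iter_rel (F : set nat) (G : nat -> nat -> set nat) (n : nat) : set nat :=
  if n is m.+1 then [set y | exists2 z, iter_rel F G m z & G m z y] else F.

(* [eval X p v y]: with oracle X, the program p on input v halts with output y. *)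
Fixpoint eval (X : set nat) k (p : program k) : k.-tuple nat -> set nat :=
  match p in program k return k.-tuple nat -> set nat with
  | Zero _ => fun _ y => y = 0
  | Succ => fun v y => y = (thead v).+1
  | Proj _ i => fun v y => y = tnth v i
  | Oracle => fun v y => y = nat_of_bool `[< X (thead v) >]
  | @Comp k m f g => fun v y =>
      exists2 w : m.-tuple nat,
        forall i : 'I_m, eval X (g i) v (tnth w i) & eval X f w y
  | PrimRec _ f g => fun v =>
      let u := [tuple of behead v] in
      iter_rel (eval X f u)
               (fun i z => eval X g [tuple of i :: z :: u]) (thead v)
  | Mu _ f => fun v y =>
      eval X f [tuple of y :: v] 0 /\
      forall i, i < y -> exists z, eval X f [tuple of i :: v] z.+1
  end.

(* A <=_T B: some program with oracle B computes the characteristic function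
   of A. *)
Definition turing_le (A B : set nat) : Prop :=
  exists p : program 1, forall n, eval B p [tuple n] (nat_of_bool `[< A n >]).

Record problem := Problem {
  instance : set (set nat);
  solution : set nat -> set (set nat) }.

Definition restrict (Q : problem) (I : set (set nat)) : problem :=
  Problem (instance Q `&` I) (solution Q).

Definition sc_le (P Q : problem) : Prop :=
  forall X, instance P X ->
  exists X', [/\ instance Q X', turing_le X' X &
    forall Y', solution Q X' Y' -> exists2 Y, solution P X Y & turing_le Y Y'].

(* A set X codes the pair (P, R), with P a subset of omega and R a binary
   relation on omega, as the join of P and { <x, y> | R x y }.  Since the Cantor
   pairing is bijective, every pair (P, R) has exactly one code. *)
Definition dom (X : set nat) : set nat := [set x | X x.*2].

Definition ord (X : set nat) (x y : nat) : Prop := X (Cantor.to_nat (x, y)).*2.+1.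

Definition is_poset (X : set nat) : Prop :=
  [/\ forall x y, ord X x y -> dom X x /\ dom X y,
      forall x, dom X x -> ord X x x,
      forall x y, ord X x y -> ord X y x -> x = y &
      forall x y z, ord X x y -> ord X y z -> ord X x z].

Definition comparable (X : set nat) (x y : nat) : Prop := ord X x y \/ ord X y x.

Definition chain (X C : set nat) : Prop :=
  C `<=` dom X /\ forall x y, C x -> C y -> comparable X x y.

Definition antichain (X C : set nat) : Prop :=
  C `<=` dom X /\ forall x y, C x -> C y -> x <> y -> ~ comparable X x y.

Definition small (X : set nat) (x : nat) : Prop :=
  finite_set [set y | dom X y /\ ~ ord X x y].

Definition large (X : set nat) (x : nat) : Prop :=
  finite_set [set y | dom X y /\ ~ ord X y x].

Definition isolated (X : set nat) (x : nat) : Prop :=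
  finite_set [set y | dom X y /\ comparable X x y].

Definition small_type (X : set nat) : Prop :=
  forall x, dom X x -> small X x \/ isolated X x.

Definition large_type (X : set nat) : Prop :=
  forall x, dom X x -> large X x \/ isolated X x.

Definition stable (X : set nat) : Prop := small_type X \/ large_type X.

Definition SCAC : problem := {|
  instance := [set X | [/\ is_poset X, infinite_set (dom X) & stable X]];
  solution := fun X => [set Y | infinite_set Y /\ (chain X Y \/ antichain X Y)] |}.

Definition SCAC_small : problem := restrict SCAC small_type.

(* Main.v *)
From Stdlib Require Arith.Cantor.
From mathcomp Require Import all_boot zify.
From mathcomp Require Import boolp classical_sets cardinality.
Require Import Defs.

Set Implicit Arguments.
Unset Strict Implicit.
Unset Printing Implicit Defensive.

Local Open Scope classical_set_scope.

(* Reversing the order exchanges small and large elements and preserves chains,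
   antichains and isolated elements, so a large-type instance is sent to its
   reversal and every solution is kept.  The reversal of X is the preimage of X
   under the map sending 2<x,y>+1 to 2<y,x>+1 and fixing the even numbers, and
   it remains to write a program for this map.  If n = 2<x,y>+1 and s = x + y,
   then s is least with n < (s+1)(s+2), and n + (2<y,x>+1) = 2s(s+2) + 2. *)

(** * Functions computable relative to an oracle *)

Definition computable X k (F : k.-tuple nat -> nat) : Prop :=
  exists p : program k, forall v, eval X p v (F v).

Section Computable.
Variable X : set nat.

Lemma eq_computable k (F G : k.-tuple nat -> nat) :
  F =1 G -> computable X F -> computable X G.
Proof. by move=> FG [p pF]; exists p => v; rewrite -FG. Qed.

Lemma computable_tnth k (i : 'I_k) : computable X (fun v => tnth v i).
Proof. by exists (Proj i). Qed.

Lemma computable_thead k : computable X (fun v : k.+1.-tuple nat => thead v).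
Proof. exact: computable_tnth. Qed.

Lemma computable_comp k m (F : m.-tuple nat -> nat)
    (G : 'I_m -> k.-tuple nat -> nat) :
  computable X F -> (forall i, computable X (G i)) ->
  computable X (fun v => F [tuple G i v | i < m]).
Proof.
move=> [p pF] /choice[q qG]; exists (Comp p q) => v /=.
by exists [tuple G i v | i < m] => // i; rewrite tnth_mktuple.
Qed.

(** Weakening by a dummy first argument: [PrimRec] and [Mu] prepend the counter, the accumulator or
    the search variable to the parameters. *)
Lemma computable_behead k (F : k.-tuple nat -> nat) :
  computable X F ->
  computable X (fun w : k.+1.-tuple nat => F [tuple of behead w]).
Proof.
move=> cF; pose G i (w : k.+1.-tuple nat) := tnth w (lift ord0 i).
have cG i : computable X (G i) by exact: computable_tnth.
apply: eq_computable (computable_comp cF cG) => w; congr F.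
by apply: eq_from_tnth => i; rewrite tnth_mktuple tnth_behead; congr tnth;
  apply: val_inj; rewrite /= inordK // ltnS.
Qed.

Lemma computable_succ k (F : k.-tuple nat -> nat) :
  computable X F -> computable X (fun v => (F v).+1).
Proof.
move=> cF; have cS : computable X (fun v : 1.-tuple nat => (thead v).+1).
  by exists Succ.
apply: eq_computable (computable_comp cS (fun=> cF)) => v.
by rewrite /thead tnth_mktuple.
Qed.

Lemma computable_cst k n : computable X (fun _ : k.-tuple nat => n).
Proof. by elim: n => [|n]; [exists (Zero k) | exact: computable_succ]. Qed.

(** [PrimRec] recurses on its first argument only, so a bound [N v] is obtained by composing with
    the map prepending [N v] to [v]. In [w], entry 0 is the counter, entry 1 the accumulator, and
    the rest are the parameters. *)
Lemma computable_iteri k (N F : k.-tuple nat -> nat)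
    (G : nat -> nat -> k.-tuple nat -> nat) :
  computable X N -> computable X F ->
  computable X (fun w : k.+2.-tuple nat =>
    G (thead w) (tnth w (inord 1)) [tuple of behead (behead w)]) ->
  computable X (fun v => iteri (N v) (fun i z => G i z v) (F v)).
Proof.
move=> cN [p pF] [q qG].
pose R (w : k.+1.-tuple nat) :=
  let u := [tuple of behead w] in iteri (thead w) (fun i z => G i z u) (F u).
have cR : computable X R.
  exists (PrimRec p q) => w; rewrite /R /=; elim: (thead w) => [|n IHn] /=; first exact: pF.
  exists (iteri n (fun i z => G i z [tuple of behead w]) (F [tuple of behead w])).
    exact: IHn.
  set z := iteri _ _ _; set u := [tuple of behead w].
  (* The double [behead] of this tuple agrees with [u] as a sequence but carries another size proof,
     hence the [val_inj] below. *)
  have := qG [tuple of n :: z :: u]; rewrite theadE (tnth_nth 0) /= inordK //=.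
  by congr (eval _ _ _ (G _ _ _)); apply: val_inj.
pose H (i : 'I_k.+1) v := tnth [tuple of N v :: v] i.
have cH i : computable X (H i).
  case: (unliftP ord0 i) => [j|] ->; last exact: cN.
  apply: eq_computable (computable_tnth j) => v.
  by rewrite /H tnthS.
apply: eq_computable (computable_comp cR cH) => v.
have -> : [tuple H i v | i < k.+1] = [tuple of N v :: v].
  by apply: eq_from_tnth => i; rewrite tnth_mktuple.
rewrite /R theadE; suff -> : [tuple of behead [tuple of N v :: v]] = v by [].
exact: val_inj.
Qed.

(** The hypotheses make [M v] the least zero of [F] in its first argument, which is what [Mu]
    searches for. *)
Lemma computable_mu k (M : k.-tuple nat -> nat)
    (F : nat -> k.-tuple nat -> nat) :
  computable X (fun w : k.+1.-tuple nat => F (thead w) [tuple of behead w]) ->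
  (forall v, F (M v) v = 0) -> (forall v i, i < M v -> 0 < F i v) ->
  computable X M.
Proof.
move=> [p pF] FM0 FM; exists (Mu p) => v /=.
have pFv i : eval X p [tuple of i :: v] (F i v).
  have := pF [tuple of i :: v]; rewrite theadE.
  by congr (eval _ _ _ (F _ _)); apply: val_inj.
split=> [|i /FM]; first by rewrite -(FM0 v).
by exists (F i v).-1; rewrite prednK.
Qed.

Section Arithmetic.
Variables (k : nat) (F G : k.-tuple nat -> nat).
Hypotheses (cF : computable X F) (cG : computable X G).

Lemma computable_add : computable X (fun v => F v + G v).
Proof.
have := @computable_iteri _ F G (fun _ z _ => z.+1) cF cG
  (computable_succ (computable_tnth _)).
by apply: eq_computable => v; elim: (F v) => //= n ->.
Qed.

(** The iteration discards the accumulator and returns the counter, whose last value is [F v - 1];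
    the start value 0 settles [F v = 0]. *)
Lemma computable_pred : computable X (fun v => (F v).-1).
Proof.
have := @computable_iteri _ F _ (fun i _ _ => i) cF
  (computable_cst k 0) (computable_thead _).
by apply: eq_computable => v; case: (F v).
Qed.

End Arithmetic.

Lemma computable_sub k (F G : k.-tuple nat -> nat) :
  computable X F -> computable X G -> computable X (fun v => F v - G v).
Proof.
move=> cF cG; have := @computable_iteri _ G F (fun _ z _ => z.-1) cG cF
  (computable_pred (computable_tnth _)).
by apply: eq_computable => v; elim: (G v) => /= [|n ->]; lia.
Qed.

Lemma computable_mul k (F G : k.-tuple nat -> nat) :
  computable X F -> computable X G -> computable X (fun v => F v * G v).
Proof.
move=> cF cG.
have := @computable_iteri _ F _ (fun _ z v => z + G v) cF (computable_cst k 0)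
  (computable_add (computable_tnth _)
    (computable_behead (computable_behead cG))).
by apply: eq_computable => v; elim: (F v) => /= [|n ->]; lia.
Qed.

(** Each round of [1 - z], started at 0, flips the parity bit. *)
Lemma computable_odd k (F : k.-tuple nat -> nat) :
  computable X F -> computable X (fun v => odd (F v) : nat).
Proof.
move=> cF.
have := @computable_iteri _ F _ (fun _ z _ => 1 - z) cF (computable_cst k 0)
  (computable_sub (computable_cst _ 1) (computable_tnth _)).
by apply: eq_computable => v; elim: (F v) => //= n ->; case: odd.
Qed.

(** This is a many-one reduction: compute [f n], then query the oracle once. *)
Lemma turing_le_preimage (f : nat -> nat) :
  computable X (fun v : 1.-tuple nat => f (thead v)) ->
  turing_le (f @^-1` X) X.
Proof.
move=> [p pf]; exists (Comp Oracle (fun=> p)) => n /=.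
exists [tuple f n] => [i|]; last by rewrite theadE.
by rewrite ord1; apply: pf [tuple n].
Qed.

End Computable.

Lemma turing_le_refl X : turing_le X X.
Proof. exact: (@turing_le_preimage X id (computable_thead X 0)). Qed.

(** * Computing the swap of coordinates on codes *)

Lemma to_natE x y :
  (Cantor.to_nat (x, y)).*2 = y.*2 + (x + y) * (x + y).+1.
Proof. by have := Cantor.to_nat_spec x y; lia. Qed.

Definition swap_code n :=
  if odd n then
    let: (x, y) := Cantor.of_nat n./2 in (Cantor.to_nat (y, x)).*2.+1
  else n.

Definition code_sum n := let: (x, y) := Cantor.of_nat n./2 in x + y.

(** With s = x + y, the half of n is s(s+1)/2 + y where y <= s, so n is at least s(s+1) and at most
    s(s+1) + 2s + 1. Both parities are covered, so the search for s needs no parity test. *)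
Lemma code_sum_bounds n :
  code_sum n * (code_sum n).+1 <= n < (code_sum n).+1 * (code_sum n).+2.
Proof.
rewrite /code_sum; case E: (Cantor.of_nat n./2) => [x y].
have := to_natE x y; rewrite -E Cantor.cancel_to_of.
have := odd_double_half n; case: odd => /=; nia.
Qed.

(** The parity bit turns the case distinction into arithmetic. For odd n the truncated subtraction
    is exact, since n and its image add up to 2s(s+2) + 2. *)
Lemma swap_codeE n :
  let s := code_sum n in
  swap_code n = odd n * (2 * (s * s.+2) + 2 - n) + (1 - odd n) * n.
Proof.
rewrite /= /swap_code /code_sum; case E: (Cantor.of_nat n./2) => [x y].
have := to_natE x y; rewrite -E Cantor.cancel_to_of to_natE.
have := odd_double_half n; case: odd => /=; nia.
Qed.

Lemma computable_code_sum X :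
  computable X (fun v : 1.-tuple nat => code_sum (thead v)).
Proof.
(* By truncation this difference vanishes exactly when n < (s+1)(s+2). *)
apply: (@computable_mu X 1 _ (fun s v => (thead v).+1 - s.+1 * s.+2)).
- apply: computable_sub.
    exact/computable_succ/(computable_behead (computable_thead X 0)).
  have cS := computable_succ (computable_thead X 1).
  exact: computable_mul cS (computable_succ cS).
- by move=> v; have := code_sum_bounds (thead v); lia.
(* For i < s, (i+1)(i+2) <= s(s+1) <= n, so the difference is positive. *)
- by move=> v i; have := code_sum_bounds (thead v); nia.
Qed.

Lemma computable_swap_code X :
  computable X (fun v : 1.-tuple nat => swap_code (thead v)).
Proof.
have cn := computable_thead X 0; have cs := computable_code_sum X.
have cc := computable_cst X 1; have co := computable_odd cn.
apply: eq_computable (fun v => esym (swap_codeE (thead v))) _.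
apply: computable_add; apply: computable_mul => //; last exact: computable_sub.
apply/computable_sub/cn/computable_add/cc/computable_mul; first exact: cc.
exact/computable_mul/computable_succ/computable_succ.
Qed.

(** * The reversed poset *)

Definition reversal (X : set nat) : set nat := swap_code @^-1` X.

Section Reversal.
Variable X : set nat.

Lemma dom_reversal : dom (reversal X) = dom X.
Proof.
by apply/funext => x; rewrite /dom /reversal /= /swap_code odd_double.
Qed.

Lemma ord_reversal x y : ord (reversal X) x y = ord X y x.
Proof.
rewrite /ord /reversal /preimage /mkset /swap_code.
set c := Cantor.to_nat (x, y).
by rewrite /= odd_double uphalf_double Cantor.cancel_of_to.
Qed.

Lemma comparable_reversal x y : comparable (reversal X) x y = comparable X x y.
Proof. by rewrite /comparable !ord_reversal orC. Qed.

Lemma chain_reversal C : chain (reversal X) C = chain X C.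
Proof.
rewrite /chain dom_reversal; congr and.
by under eq_forall do under eq_forall do rewrite comparable_reversal.
Qed.

Lemma antichain_reversal C : antichain (reversal X) C = antichain X C.
Proof.
rewrite /antichain dom_reversal; congr and.
by under eq_forall do under eq_forall do rewrite comparable_reversal.
Qed.

Lemma small_reversal x : small (reversal X) x = large X x.
Proof.
rewrite /small /large dom_reversal; congr finite_set.
by apply/funext => y /=; rewrite ord_reversal.
Qed.

Lemma isolated_reversal x : isolated (reversal X) x = isolated X x.
Proof.
rewrite /isolated dom_reversal; congr finite_set.
by apply/funext => y /=; rewrite comparable_reversal.
Qed.

Lemma small_type_reversal : large_type X -> small_type (reversal X).
Proof.
move=> X_large x; rewrite dom_reversal small_reversal isolated_reversal.
exact: X_large.
Qed.

Lemma is_poset_reversal : is_poset X -> is_poset (reversal X).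
Proof.
rewrite /is_poset dom_reversal => -[Xdom Xrefl Xanti Xtrans].
split=> [x y|x|x y|x y z]; rewrite !ord_reversal.
- by case/Xdom.
- exact: Xrefl.
- by move=> yx xy; apply: Xanti.
- by move=> yx zy; apply: Xtrans zy yx.
Qed.

End Reversal.

(** * The two reductions *)

Theorem theorem7 : sc_le SCAC SCAC_small /\ sc_le SCAC_small SCAC.
Proof.
split=> X; last first.
  (* A restriction has the same solutions, so the instance and each solution are kept. *)
  move=> [X_inst _]; exists X; split=> // [|Y Ysol].
    exact: turing_le_refl.
  by exists Y => //; apply: turing_le_refl.
move=> [Xposet Xinf [X_small|X_large]].
  (* A small-type instance already belongs to the restriction; only the large type needs
     reversing. *)
  exists X; split=> [||Y Ysol].
  - by split=> //; split=> //; left.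
  - exact: turing_le_refl.
  - by exists Y => //; apply: turing_le_refl.
have rX_small := small_type_reversal X_large.
exists (reversal X); split=> [||Y [Yinf Ysol]].
- split=> //; split; [exact: is_poset_reversal | by rewrite dom_reversal |].
  by left.
- exact/turing_le_preimage/computable_swap_code.
- exists Y; last exact: turing_le_refl.
  by split=> //; rewrite -chain_reversal -antichain_reversal.
Qed.
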